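(* Let $\Bbbk$ be a field and let $G$ be a finite, simple, connected, nontrivial graph with edge ideal $I(G)$. Then the LCM lattice $\mathcal{L}_{I(G)}$ is coatomic if and only if $G=\operatorname{St}_n$ (up to isomorphism) for some $n$ or every vertex of $G$ has degree at least $2$.
   Context: A graph is nontrivial if it has at least one edge. For a graph $G$ on vertex set $\{1,\ldots,n\}$, $I(G)=(x_ix_j\mid\{i,j\}\in E(G))\subseteq\Bbbk[x_1,\ldots,x_n]$. $\operatorname{St}_n$ is the star graph with vertex set $\{1,\ldots,n\}$ and edges $\{1,i\}$ for $2\le i\le n$. The LCM lattice $\mathcal{L}_I$ of a monomial ideal $I$ is the set of least common multiples of subsets of its minimal monomial generators (the lcm of the empty set is $1$), ordered by divisibility; it is a finite lattice with join lcm. In a finite lattice a coatom is an element covered by $\hat 1$; the lattice is coatomic if every element is a (possibly empty) meet of coatoms. *)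

(* Defs.v *)
From HB Require Import structures.
From mathcomp Require Import all_boot all_order all_algebra.
From mathcomp Require Import mpoly.

Set Implicit Arguments.
Unset Strict Implicit.
Unset Printing Implicit Defensive.

Import GRing.Theory.
Local Open Scope ring_scope.

(* A simple graph on T is a symmetric irreflexive e : rel T. *)

Definition nontrivial_graph (T : finType) (e : rel T) : Prop :=
  exists x y, e x y.

Definition connected_graph (T : finType) (e : rel T) : Prop :=
  forall x y, connect e x y.

Definition degree (T : finType) (e : rel T) (x : T) : nat :=
  #|[set y | e x y]|.

Definition graph_iso (T T' : finType) (e : rel T) (e' : rel T') : Prop :=
  exists2 f : T -> T', bijective f & forall x y, e' (f x) (f y) = e x y.

(* Vertices are numbered from 0, so the centre of the star is 0. *)
Definition star (m : nat) : rel 'I_m :=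
  [rel x y : 'I_m | ((x == 0 :> nat) && (y != 0 :> nat))
                 || ((y == 0 :> nat) && (x != 0 :> nat))]%N.
Arguments star : clear implicits.

Definition ideal_gen (A : comNzRingType) (S : A -> Prop) (p : A) : Prop :=
  exists2 s : seq (A * A),
    (forall c, c \in s -> S c.2) & p = \sum_(c <- s) c.1 * c.2.

Definition edge_ideal (k : fieldType) (n : nat) (e : rel 'I_n) :
    {mpoly k[n]} -> Prop :=
  ideal_gen (fun p => exists i j, e i j /\ p = 'X_i * 'X_j).

Section MonomialIdeal.

Variables (k : fieldType) (n : nat).
Implicit Types (I : {mpoly k[n]} -> Prop) (M : 'X_{1..n} -> Prop).

Definition mon_gen I M : Prop :=
  forall p, I p <-> ideal_gen (fun q => exists2 m, M m & q = 'X_[m]) p.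

Definition min_mon_gen I M : Prop :=
  mon_gen I M /\
  forall M', (forall m, M' m -> M m) -> mon_gen I M' -> forall m, M m -> M' m.

(* A monomial ideal has exactly one minimal set of monomial generators, so the
   existential picks out its elements. *)
Definition min_generator I (m : 'X_{1..n}) : Prop :=
  exists2 M, min_mon_gen I M & M m.

(* Membership in the carrier of the LCM lattice of I.  The minimal generators
   form a finite set, hence finite sequences capture all of its subsets. *)
Definition lcm_lattice I (m : 'X_{1..n}) : Prop :=
  exists2 s : seq 'X_{1..n},
    (forall g, g \in s -> min_generator I g) & m = \big[@mlcm n/0%MM]_(g <- s) g.

End MonomialIdeal.

(* Order-theoretic notions in the subset L of T ordered by le; in particular
   meets are greatest lower bounds computed inside L, not in T. *)
Section Coatomic.

Variables (T : Type) (le : rel T) (L : T -> Prop).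

Definition is_top (t : T) : Prop := L t /\ forall x, L x -> le x t.

Definition covered_by (x y : T) : Prop :=
  [/\ L x, L y, le x y, x <> y &
      forall z, L z -> le x z -> le z y -> z = x \/ z = y].

Definition coatom (c : T) : Prop := exists2 t, is_top t & covered_by c t.

Definition is_meet (A : T -> Prop) (x : T) : Prop :=
  [/\ L x, forall a, A a -> le x a &
      forall y, L y -> (forall a, A a -> le y a) -> le y x].

Definition coatomic : Prop :=
  forall x, L x ->
    exists2 A : T -> Prop, (forall a, A a -> coatom a) & is_meet A x.

End Coatomic.

(* The order on 'X_{1..n} is the pointwise one, i.e. divisibility of monomials;
   the canonical order of 'X_{1..n} is instead a total monomial order. *)
Definition lcm_lattice_coatomic (k : fieldType) (n : nat)
    (I : {mpoly k[n]} -> Prop) : Prop :=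
  coatomic (fun m1 m2 : 'X_{1..n} => (m1 <= m2)%MM) (lcm_lattice I).

(* Main.v *)
(* Divisibility makes the minimal generators of I(G) exactly the edge monomials,
   so the LCM lattice is the lattice of vertex sets inducing a subgraph without
   isolated vertices, ordered by inclusion.  If all degrees are at least 2, the
   complements of single vertices are coatoms and everything is an intersection
   of these; stars are handled similarly.  Conversely, let v be a leaf with
   neighbour w.  If there are edges wu and ux with x != w, then V \ {v} is in the
   lattice, and a coatom missing w misses v, hence would be V \ {v}: so every
   coatom contains w, and {u, x} cannot be separated from {w, u, x} by coatoms.
   If there are no such edges, connectedness forces a star centred at w. *)

(* mpoly rebinds [symmetric], so it has to come before the ssrbool one. *)
From mathcomp Require Import mpoly perm.
Require Import Defs.
From mathcomp Require Import all_boot all_algebra.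

Set Implicit Arguments.
Unset Strict Implicit.
Unset Printing Implicit Defensive.

Import GRing.Theory.

(** * Transport of coatomicity along an order isomorphism *)

Lemma eq_coatomic_embed (T T' : Type) (le : rel T) (le' : rel T')
    (L : T -> Prop) (L' : T' -> Prop) (f : T' -> T) :
    injective f -> (forall a b, le (f a) (f b) = le' a b) ->
    (forall t, L t <-> exists2 a, L' a & t = f a) ->
  coatomic le L <-> coatomic le' L'.
Proof.
move=> f_inj f_le fL.
have Lf a : L (f a) <-> L' a.
  by split=> [/fL[b L'b /f_inj->] // | L'a]; apply/fL; exists a.
have topf a : is_top le L (f a) <-> is_top le' L' a.
  split=> [[/Lf La topa] | [La topa]]; split=> //.
  - by move=> b /Lf /topa; rewrite f_le.
  - exact/Lf.
  - by move=> _ /fL[b /topa leb ->]; rewrite f_le.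
have covf a b : covered_by le L (f a) (f b) <-> covered_by le' L' a b.
  split=> [[/Lf La /Lf Lb leab neab cov] | [La Lb leab neab cov]].
    split=> //; first by rewrite -f_le.
      by move=> eqab; apply: neab; rewrite eqab.
    move=> c /Lf Lc; rewrite -!f_le => leac lecb.
    by case: (cov _ Lc leac lecb) => /f_inj; [left | right].
  split; [exact/Lf | exact/Lf | by rewrite f_le | by move/f_inj |].
  move=> _ /fL[c Lc ->]; rewrite !f_le => leac lecb.
  by case: (cov _ Lc leac lecb) => ->; [left | right].
have coatf a : coatom le L (f a) <-> coatom le' L' a.
  split=> [[t topt] | [t topt cov]]; last by exists (f t); [apply/topf | apply/covf].
  have /fL[b _ eqt] := topt.1; rewrite eqt in topt *.
  by move/covf=> cov; exists b => //; apply/topf.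
split=> coat.
  move=> a L'a; have [|A coatA [_ lbA glbA]] := coat (f a); first exact/Lf.
  exists (fun b => A (f b)) => [b /coatA/coatf // |].
  split=> // [b /lbA | b Lb lbb]; first by rewrite f_le.
  (* A coatom belongs to [L], so each [t] in [A] is the image of some [c]. *)
  rewrite -f_le; apply: glbA => [|t At]; first exact/Lf.
  have [_ _ [Lt _ _ _ _]] := coatA _ At.
  by have /fL[c _ eqt] := Lt; rewrite eqt f_le; apply: lbb; rewrite -eqt.
move=> _ /fL[a La ->]; have [A coatA [_ lbA glbA]] := coat a La.
exists (fun t => exists2 b, A b & t = f b) => [_ [b /coatA cb ->]|]; first exact/coatf.
split; first exact/Lf.
  by move=> _ [b Ab ->]; rewrite f_le; apply: lbA.
move=> _ /fL[b Lb ->] lbb; rewrite f_le; apply: glbA => // c Ac.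
by rewrite -f_le; apply: lbb; exists c.
Qed.

(** * Minimal generators of monomial ideals *)

Lemma sub_ideal_gen (A : comNzRingType) (S S' : A -> Prop) (p : A) :
  (forall q, S q -> S' q) -> ideal_gen S p -> ideal_gen S' p.
Proof. by move=> sSS' [s Ss ->]; exists s => // c /Ss /sSS'. Qed.

Lemma mem_ideal_gen (A : comNzRingType) (S : A -> Prop) (p : A) :
  S p -> ideal_gen S p.
Proof.
move=> Sp; exists [:: (1%R, p)] => [c|]; first by rewrite inE => /eqP->.
by rewrite big_seq1 mul1r.
Qed.

Lemma mcoeffMX_neq0 (k : fieldType) (n : nat) (p : {mpoly k[n]})
    (m m' : 'X_{1..n}) :
  ((p * 'X_[m'])@_m)%R != 0%R -> (m' <= m)%MM.
Proof.
rewrite -mcoeff_msupp => /msuppM_le; rewrite msuppX => /allpairsP[[p1 p2]] /=.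
by rewrite mem_seq1 => -[_ /eqP-> ->]; apply: lem_addl.
Qed.

(** Some summand must contribute to the nonzero coefficient at [m], and every monomial in a multiple
    of ['X_[m']] is divisible by [m']. *)
Lemma ideal_gen_monomial (k : fieldType) (n : nat) (M : 'X_{1..n} -> Prop)
    (m : 'X_{1..n}) :
    ideal_gen (fun q : {mpoly k[n]} => exists2 m', M m' & q = 'X_[m']%R) 'X_[m]%R ->
  exists2 m', M m' & (m' <= m)%MM.
Proof.
case=> s sM Xm; have : (('X_[m] : {mpoly k[n]})@_m != 0)%R.
  by rewrite mcoeffX eqxx oner_eq0.
rewrite Xm raddf_sum /= => sum_neq0.
have /hasP[[p q] pq_s /=] : has (fun c => (c.1 * c.2)@_m != 0)%R s.
  apply: contraNT sum_neq0 => /hasPn s0; apply/eqP/big1_seq => c /s0.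
  by rewrite negbK => /eqP.
by have [m' Mm' /= ->] := sM _ pq_s; move/mcoeffMX_neq0; exists m'.
Qed.

(** For two monomial generating sets, each element of one is divisible by an element of the other.
    Going from [M] to [M'] and back gives a chain of divisors that the antichain condition
    collapses, so [M] lies in every [M']. *)
Lemma min_generator_antichain (k : fieldType) (n : nat)
    (I : {mpoly k[n]} -> Prop) (M : 'X_{1..n} -> Prop) :
    mon_gen I M -> (forall m m', M m -> M m' -> (m <= m')%MM -> m = m') ->
  forall m, min_generator I m <-> M m.
Proof.
move=> genM antiM.
have gen_le M1 M2 m : mon_gen I M1 -> mon_gen I M2 -> M1 m ->
    exists2 m', M2 m' & (m' <= m)%MM.
  move=> gen1 gen2 M1m; apply: (@ideal_gen_monomial k).
  by apply/gen2/gen1/mem_ideal_gen; exists m.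
have subM M' : mon_gen I M' -> forall m, M m -> M' m.
  move=> genM' m Mm; have [m' M'm' lem'm] := gen_le _ _ _ genM genM' Mm.
  have [m'' Mm'' lem''m'] := gen_le _ _ _ genM' genM M'm'.
  have eqm'' : m'' = m by apply: antiM (lepm_trans lem''m' lem'm).
  suff -> : m = m' by [].
  apply/mnmP=> i; apply/eqP; rewrite eqn_leq (mnm_lepP lem'm) andbT.
  by rewrite -eqm'' (mnm_lepP lem''m').
move=> m; split=> [[M' [genM' minM'] /minM'] | Mm].
  by apply=> //; apply: subM.
by exists M => //; split=> // M' _ /subM; apply.
Qed.

(** * From the LCM lattice of an edge ideal to vertex sets *)

Definition sqfree_mnm (n : nat) (A : {set 'I_n}) : 'X_{1..n} :=
  [multinom (i \in A : nat) | i < n].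

Lemma lem_sqfree_mnm (n : nat) (A B : {set 'I_n}) :
  (sqfree_mnm A <= sqfree_mnm B)%MM = (A \subset B).
Proof.
apply/mnm_lepP/subsetP => [leAB i iA | sAB i].
  by have := leAB i; rewrite !mnmE iA; case: (i \in B).
by rewrite !mnmE; have := sAB i; case: (i \in A) => // ->.
Qed.

Lemma sqfree_mnm_inj (n : nat) : injective (@sqfree_mnm n).
Proof.
move=> A B eqAB; apply/eqP; rewrite eqEsubset -!lem_sqfree_mnm.
by rewrite eqAB lepm_refl.
Qed.

Lemma mlcm_sqfree_mnm (n : nat) (A B : {set 'I_n}) :
  mlcm (sqfree_mnm A) (sqfree_mnm B) = sqfree_mnm (A :|: B).
Proof. by apply/mnmP=> i; rewrite !mnmE inE; do 2 case: (i \in _). Qed.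

Lemma sqfree_mnm0 (n : nat) : sqfree_mnm set0 = 0%MM :> 'X_{1..n}.
Proof. by apply/mnmP=> i; rewrite !mnmE inE. Qed.

Lemma sqfree_mnm2 (n : nat) (i j : 'I_n) :
  i != j -> sqfree_mnm [set i; j] = (U_(i) + U_(j))%MM.
Proof.
move=> ne_ij; apply/mnmP=> h; rewrite !mnmE !inE (eq_sym i) (eq_sym j).
by case: (eqVneq h i) => [->|_] //; rewrite (negbTE ne_ij).
Qed.

Definition no_isolated (T : finType) (e : rel T) (A : {set T}) : Prop :=
  forall x, x \in A -> exists2 y, y \in A & e x y.

Lemma no_isolated0 (T : finType) (e : rel T) : no_isolated e set0.
Proof. by move=> x; rewrite inE. Qed.

Lemma no_isolatedU (T : finType) (e : rel T) (A B : {set T}) :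
  no_isolated e A -> no_isolated e B -> no_isolated e (A :|: B).
Proof.
move=> noA noB x /setUP[/noA | /noB] [y yA exy]; exists y => //.
  by rewrite inE yA.
by rewrite inE yA orbT.
Qed.

Lemma no_isolated2 (T : finType) (e : rel T) (x y : T) :
  symmetric e -> e x y -> no_isolated e [set x; y].
Proof.
move=> e_sym exy z /set2P[] ->; first by exists y; rewrite ?set22.
by exists x; rewrite ?set21 // e_sym.
Qed.

(** Without loops, edges are two-element sets, and inclusion between sets of equal size is equality,
    so the edge monomials form an antichain. *)
Lemma edge_ideal_min_generator (k : fieldType) (n : nat) (e : rel 'I_n)
    (m : 'X_{1..n}) :
    irreflexive e ->
  min_generator (edge_ideal (k := k) e) m <->
  exists i j, e i j /\ m = sqfree_mnm [set i; j].
Proof.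
move=> e_irr; have ne_e i j : e i j -> i != j.
  by apply: contraTneq => ->; rewrite e_irr.
apply: (min_generator_antichain
  (M := fun m => exists i j, e i j /\ m = sqfree_mnm [set i; j])) => [p|].
  split; apply: sub_ideal_gen => q.
    move=> [i [j [eij ->]]]; exists (sqfree_mnm [set i; j]); first by exists i, j.
    by rewrite sqfree_mnm2 ?ne_e // mpolyXD.
  case=> _ [i [j [eij ->]]] ->; exists i, j; split=> //.
  by rewrite sqfree_mnm2 ?ne_e // mpolyXD.
move=> _ _ [i [j [/ne_e neij ->]]] [i' [j' [/ne_e neij' ->]]].
rewrite lem_sqfree_mnm => sub; congr sqfree_mnm; apply/eqP.
by rewrite eqEcard sub !cards2 neij neij'.
Qed.

Lemma edge_ideal_lcm_lattice (k : fieldType) (n : nat) (e : rel 'I_n)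
    (m : 'X_{1..n}) :
    symmetric e -> irreflexive e ->
  lcm_lattice (edge_ideal (k := k) e) m <->
  exists2 A, no_isolated e A & m = sqfree_mnm A.
Proof.
move=> e_sym e_irr; split=> [[s s_gen ->] | [A noA ->]].
  rewrite big_seq; elim/big_rec: _ => [|g _ /s_gen g_gen [A noA ->]].
    by exists set0; [apply: no_isolated0 | rewrite sqfree_mnm0].
  have [i [j [eij ->]]] := (edge_ideal_min_generator k g e_irr).1 g_gen.
  exists ([set i; j] :|: A); last by rewrite mlcm_sqfree_mnm.
  exact/no_isolatedU/noA/no_isolated2.
(* All edges inside [A]: their union is [A] precisely because no vertex of [A] is isolated in it. *)
pose es := [seq p : 'I_n * 'I_n <- enum predT | [&& p.1 \in A, p.2 \in A & e p.1 p.2]].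
exists [seq sqfree_mnm [set p.1; p.2] | p <- es] => [g|].
  case/mapP=> p; rewrite mem_filter => /andP[/and3P[_ _ ep] _] ->.
  by apply/edge_ideal_min_generator => //; exists p.1, p.2.
rewrite big_map -(big_morph _ (fun B C => esym (mlcm_sqfree_mnm B C)) (sqfree_mnm0 n)).
congr sqfree_mnm; apply/setP=> x; rewrite bigcup_seq.
apply/idP/bigcupP => [xA | [p]].
  have [y yA exy] := noA x xA; exists (x, y); last by rewrite set21.
  by rewrite mem_filter /= xA yA exy mem_enum.
by rewrite mem_filter => /andP[/and3P[p1A p2A _] _] /set2P[] ->.
Qed.

Lemma edge_ideal_coatomicE (k : fieldType) (n : nat) (e : rel 'I_n) :
    symmetric e -> irreflexive e ->
  lcm_lattice_coatomic (edge_ideal (k := k) e) <->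
  coatomic (fun A B : {set 'I_n} => A \subset B) (no_isolated e).
Proof.
move=> e_sym e_irr; apply: eq_coatomic_embed (@sqfree_mnm_inj n) _ _ => [A B|m].
  exact: lem_sqfree_mnm.
exact: edge_ideal_lcm_lattice.
Qed.

(** * Coatoms among vertex sets, and the case of minimum degree 2 *)

Lemma no_isolatedT (T : finType) (e : rel T) :
    symmetric e -> connected_graph e -> nontrivial_graph e ->
  no_isolated e [set: T].
Proof.
move=> e_sym e_conn [a [b eab]] x _.
have /connectP[[|y p] /= ep eqa] := e_conn x a; first by exists b; rewrite -?eqa.
by exists y => //; case/andP: ep.
Qed.

Lemma coatomE (T : finType) (e : rel T) (A : {set T}) :
    no_isolated e [set: T] ->
  coatom (fun A B : {set T} => A \subset B) (no_isolated e) A <->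
  [/\ no_isolated e A, A != setT &
      forall B, no_isolated e B -> A \subset B -> B = A \/ B = setT].
Proof.
move=> noT; split=> [[t [_ topt] [noA _ _ neA maxA]] | [noA neA maxA]].
  have tT : t = setT by apply/eqP; rewrite eqEsubset subsetT topt.
  rewrite tT in neA maxA; split=> //; first exact/eqP.
  by move=> B noB sAB; apply: maxA; rewrite ?subsetT.
exists setT; split=> //; first exact/eqP.
by move=> B noB sAB _; apply: maxA.
Qed.

Lemma coatom_setC1 (T : finType) (e : rel T) (x : T) :
    no_isolated e [set: T] -> no_isolated e (~: [set x]) ->
  coatom (fun A B : {set T} => A \subset B) (no_isolated e) (~: [set x]).
Proof.
move=> noT noC; apply/coatomE => //; split=> // [|B _].
  by apply/eqP/setP => /(_ x); rewrite !inE eqxx.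
case: (boolP (x \in B)) => [xB|xB] sxB; [right | left]; apply/setP => y.
  rewrite inE; case: (eqVneq y x) => [-> // | neyx].
  by apply: (subsetP sxB); rewrite !inE.
rewrite !inE; case: (eqVneq y x) => [->|neyx]; first exact: negbTE.
by apply: (subsetP sxB); rewrite !inE.
Qed.

(** The natural candidate is the set of all coatoms above [A]; its meet is [A] once each [B] outside
    [A] is excluded by one of them. *)
Lemma coatomic_separated (T : finType) (e : rel T) :
    (forall A B, no_isolated e A -> no_isolated e B -> ~~ (B \subset A) ->
      exists C, [/\ coatom (fun A B : {set T} => A \subset B) (no_isolated e) C,
                    A \subset C & ~~ (B \subset C)]) ->
  coatomic (fun A B : {set T} => A \subset B) (no_isolated e).
Proof.
move=> sep A noA.
exists (fun C => coatom (fun A B : {set T} => A \subset B) (no_isolated e) C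
                 /\ A \subset C) => [C [] // |].
split=> // [C [] // | B noB lbB]; case: (boolP (B \subset A)) => // nsBA.
by have [C [coatC sAC /negP[]]] := sep A B noA noB nsBA; apply: lbB.
Qed.

Lemma coatomic_min_degree2 (T : finType) (e : rel T) :
    (forall x, 2 <= degree e x) ->
  coatomic (fun A B : {set T} => A \subset B) (no_isolated e).
Proof.
(* Deleting any one vertex [z] leaves each [x] with a neighbour. *)
move=> deg2; have nbr x z : exists2 y, y != z & e x y.
  have : 0 < #|[set y | e x y] :\ z|.
    by have := deg2 x; rewrite /degree (cardsD1 z); case: (z \in _) => // /ltnW.
  by case/card_gt0P=> y; rewrite !inE => /andP[]; exists y.
apply: coatomic_separated => A B noA noB /subsetPn[x xB xA].
have noT : no_isolated e [set: T].
  by move=> y _; have [z _ eyz] := nbr y y; exists z; rewrite ?inE.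
exists (~: [set x]); split.
- apply: coatom_setC1 => // y _; have [z nezx eyz] := nbr y x.
  by exists z; rewrite // !inE.
- by apply/subsetP=> y yA; rewrite !inE; apply: contraNneq xA => <-.
- by apply/subsetPn; exists x; rewrite // !inE negbK.
Qed.

(** * Stars *)

Definition star_at (T : finType) (e : rel T) (c : T) : Prop :=
  forall x y, e x y = ((x == c) && (y != c)) || ((y == c) && (x != c)).

(** Positivity of [n] excludes the empty graph, which is isomorphic to [star 0] but has no
    centre. *)
Lemma graph_iso_star (n : nat) (e : rel 'I_n) :
    (0 < n) -> (exists m, graph_iso e (star m)) <-> exists c, star_at e c.
Proof.
case: n e => // n e _; split=> [[m [f [g fK gK] ef]] | [c ec]].
  case: m f g fK gK ef => [|m] f g fK gK ef; first by case: (f ord0).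
  have eq0 z : (f z == 0 :> nat) = (z == g ord0) by rewrite -(can2_eq fK gK).
  by exists (g ord0) => x y; rewrite -ef /star /= !eq0.
exists n.+1, (tperm c ord0).
  by exists (tperm c ord0); apply: tpermK.
move=> x y; rewrite ec /star /=.
have eq0 z : (tperm c ord0 z == 0 :> nat) = (z == c).
  by rewrite -[RHS](inj_eq (@perm_inj _ (tperm c ord0))) tpermL.
by rewrite !eq0.
Qed.

(** Every nonempty member of the lattice contains the centre, so members are told apart by the other
    vertices, whose complements are coatoms unless the star is a single edge. *)
Lemma coatomic_star (T : finType) (e : rel T) (c : T) :
    no_isolated e [set: T] -> star_at e c ->
  coatomic (fun A B : {set T} => A \subset B) (no_isolated e).
Proof.
move=> noT ec; have mem_c A x : no_isolated e A -> x \in A -> c \in A.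
  move=> noA xA; have [y yA] := noA x xA; rewrite ec.
  by case/orP=> /andP[/eqP<-].
apply: coatomic_separated => A B noA noB nsBA.
(* If the vertex found is the centre, then [A] is empty and a neighbour of [c] in [B] serves
   instead. *)
have [x [xB xA nexc]] : exists x, [/\ x \in B, x \notin A & x != c].
  have [x xB xA] := subsetPn nsBA.
  case: (eqVneq x c) => [eqxc | nexc]; last by exists x.
  have [y yB] := noB x xB; rewrite eqxc ec eqxx /= andbF orbF => neyc.
  by exists y; split=> //; apply: contra xA => yA; rewrite eqxc (mem_c A y).
case: (pickP [pred y | (y != c) && (y != x)]) => [y /andP[neyc neyx] | onlycx].
  exists (~: [set x]); split.
  - apply: coatom_setC1 => // z; rewrite !inE => nezx.
    case: (eqVneq z c) => [-> | nezc].
      by exists y; rewrite ?inE // ec eqxx neyc.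
    by exists c; rewrite ?ec ?eqxx ?nezc ?orbT // !inE eq_sym.
  - by apply/subsetP=> z zA; rewrite !inE; apply: contraNneq xA => <-.
  - by apply/subsetPn; exists x; rewrite // !inE negbK.
(* Now [c] and [x] are the only vertices, the lattice consists of the empty set and the whole set,
   and the empty set is the coatom. *)
have A0 : A = set0.
  apply/setP=> z; rewrite inE; apply: contraNF xA => zA.
  have [y yA] := noA c (mem_c A z noA zA); rewrite ec eqxx /= andbF orbF => neyc.
  by have := onlycx y; rewrite /= neyc => /negbFE/eqP <-.
exists set0; split; [|by rewrite A0|by apply/subsetPn; exists x; rewrite ?inE].
apply/coatomE => //; split; first exact: no_isolated0.
  by apply/eqP/setP => /(_ x); rewrite !inE.
move=> D noD _; case: (set_0Vmem D) => [|[z zD]]; [by left | right].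
have cD := mem_c D z noD zD; have [y yD] := noD c cD.
rewrite ec eqxx /= andbF orbF => neyc; apply/setP=> t; rewrite inE.
case: (eqVneq t c) => [-> // | netc].
have := onlycx y; have := onlycx t; rewrite /= netc neyc.
by move=> /negbFE/eqP-> /negbFE/eqP<-.
Qed.

(** * Leaves outside stars *)

Lemma leaf_star_or_edge (T : finType) (e : rel T) (w : T) :
    symmetric e -> irreflexive e -> connected_graph e ->
  star_at e w \/ exists u x, [/\ e w u, e u x & x != w].
Proof.
move=> e_sym e_irr e_conn.
case: (boolP [exists u, exists x, [&& e w u, e u x & x != w]]).
  by case/existsP=> u /existsP[x /and3P[ewu eux nexw]]; right; exists u, x.
move=> far; left.
have near u x : e w u -> e u x -> x = w.
  move=> ewu eux; apply: contraNeq far => nexw.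
  by apply/existsP; exists u; apply/existsP; exists x; rewrite ewu eux.
(* Induction along a path from [w]: the vertex before the last is [w] or a neighbour of [w], and in
   the latter case [near] sends the last one back to [w]. *)
have adj x : x != w -> e w x.
  have /connectP[p] := e_conn w x.
  elim/last_ind: p x => [|p y IHp] x /=; first by move=> _ ->; rewrite eqxx.
  rewrite rcons_path last_rcons => /andP[ep ey] -> neyw.
  have := IHp _ ep erefl; case: eqP => [<- // | _ /(_ isT) ewl].
  by rewrite (near _ _ ewl ey) eqxx in neyw.
move=> x y; case: (eqVneq x w) => [-> | nexw] /=.
  rewrite andbF orbF; case: (eqVneq y w) => [-> | /adj] //; exact: e_irr.
rewrite andbT; case: (eqVneq y w) => [-> | neyw]; first by rewrite e_sym adj.
by apply: contraNF neyw => /(near x y (adj x nexw)) ->.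
Qed.

Lemma leaf_not_coatomic (T : finType) (e : rel T) (v w u x : T) :
    symmetric e -> irreflexive e -> no_isolated e [set: T] ->
    (forall y, e v y -> y = w) -> e w u -> e u x -> x != w ->
  ~ coatomic (fun A B : {set T} => A \subset B) (no_isolated e).
Proof.
move=> e_sym e_irr noT leafv ewu eux nexw coat.
have neuw : u != w by apply: contraTneq ewu => ->; rewrite e_irr.
(* If [u] were [v], its neighbour [x] would have to be [w]. *)
have neuv : u != v by apply: contraNneq nexw => equv; rewrite (leafv x) -?equv.
have evw : e v w by have [y _ evy] := noT v (in_setT v); rewrite -(leafv y).
(* Only [w] loses a neighbour when [v] is deleted, and it keeps [u]. *)
have noCv : no_isolated e (~: [set v]).
  move=> y; rewrite !inE => neyv.
  case: (eqVneq y w) => [-> | neyw]; first by exists u; rewrite ?inE.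
  have [z _ eyz] := noT y (in_setT y); exists z; rewrite // !inE.
  by apply: contraNneq neyw => eqzv; rewrite (leafv y) // -eqzv e_sym.
have w_coatom C :
    coatom (fun A B : {set T} => A \subset B) (no_isolated e) C -> w \in C.
  case/(coatomE _ noT)=> noC neC maxC; apply: contraT => wC.
  have vC : v \notin C.
    by apply: contra wC => /noC[y yC /leafv <-].
  have sCv : C \subset ~: [set v].
    by apply/subsetP=> y yC; rewrite !inE; apply: contraNneq vC => <-.
  have newv : w != v by apply: contraTneq evw => ->; rewrite e_irr.
  case: (maxC _ noCv sCv) => eqC; first by rewrite -eqC !inE newv in wC.
  by have := in_setT v; rewrite -eqC !inE eqxx.
have [A coatA [_ lbA glbA]] := coat [set u; x] (no_isolated2 e_sym eux).
(* Every coatom above [{u, x}] also contains [w], so the meet property would put [w] into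
   [{u, x}]. *)
have /subsetP/(_ w) : [set w; u] :|: [set u; x] \subset [set u; x].
  apply: glbA => [|C AC]; first by apply: no_isolatedU; apply: no_isolated2.
  rewrite subUset lbA // andbT subUset !sub1set (w_coatom _ (coatA _ AC)) /=.
  by apply: (subsetP (lbA _ AC)); rewrite set21.
rewrite !inE eqxx => /(_ isT).
by rewrite !(eq_sym w) (negbTE nexw) (negbTE neuw).
Qed.

Theorem theorem6p7 (k : fieldType) (n : nat) (e : rel 'I_n)
    (e_sym : symmetric e) (e_irr : irreflexive e)
    (e_conn : connected_graph e) (e_nontriv : nontrivial_graph e) :
  lcm_lattice_coatomic (edge_ideal (k := k) e) <->
  (exists m, graph_iso e (star m)) \/ (forall x, (2 <= degree e x)%N).
Proof.
have noT := no_isolatedT e_sym e_conn e_nontriv.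
have n_gt0 : 0 < n by case: e_nontriv => -[i ltin] _; apply: leq_trans ltin.
have coatE := edge_ideal_coatomicE k e_sym e_irr.
have starE := graph_iso_star e n_gt0.
split=> [/coatE coat | [/starE[c ec] | deg2]]; last 2 first.
- exact/coatE/(coatomic_star noT ec).
- exact/coatE/(coatomic_min_degree2 deg2).
case: (boolP [forall x, 2 <= degree e x]) => [/forallP|]; first by right.
case/forallPn=> v; rewrite -ltnNge ltnS => deg1; left; apply/starE.
(* The neighbour of the leaf [v] is the only possible centre here; the alternative in
   [leaf_star_or_edge] contradicts coatomicity. *)
have [w _ evw] := noT v (in_setT v); exists w.
have leafv y : e v y -> y = w.
  by move=> evy; apply: (card_le1_eqP deg1); rewrite inE.
have [// | [u [x [ewu eux nexw]]]] := leaf_star_or_edge w e_sym e_irr e_conn.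
by case: (leaf_not_coatomic e_sym e_irr noT leafv ewu eux nexw coat).
Qed.
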